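(* Let $\{Q\}$ be a system of quasiseparable polynomials, $\deg Q_k=k$, satisfying $$\begin{bmatrix}G_k(x)\\Q_k(x)\end{bmatrix}=\begin{bmatrix}\alpha_k&\beta_k\\ \gamma_k&\delta_kx+\theta_k\end{bmatrix}\begin{bmatrix}G_{k-1}(x)\\Q_{k-1}(x)\end{bmatrix},\qquad k=1,\dots,n,$$ with auxiliary polynomials $G_k$, $G_0=0$. Then the system of generalized associated polynomials $\widehat Q=\{\widehat Q_0(x),\dots,\widehat Q_{n-1}(x)\}$ is also quasiseparable and satisfies the recurrence relations $$\begin{bmatrix}\widehat G_k(x)\\\widehat Q_k(x)\end{bmatrix}=\begin{bmatrix}\widehat\alpha_k&\widehat\beta_k\\ \widehat\gamma_k&\widehat\delta_kx+\widehat\theta_k\end{bmatrix}\begin{bmatrix}\widehat G_{k-1}(x)\\\widehat Q_{k-1}(x)\end{bmatrix},\qquad k=1,\dots,n-1,$$ with auxiliary polynomials $\widehat G_k$, $\widehat G_0=0$, where $$\widehat\alpha_k=\alpha_{n-k+1},\quad\widehat\beta_k=\frac{\gamma_{n-k+1}}{\delta_{n-k+1}},\quad\widehat\gamma_k=\beta_{n-k+1}\cdot\delta_{n-k},\quad\widehat\delta_k=\delta_{n-k},\quad\widehat\theta_k=\frac{\delta_{n-k}}{\delta_{n-k+1}}\theta_{n-k+1}.$$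
   Context: Generalized associated polynomials: let $Q_0,\dots,Q_n$ be complex polynomials with $\deg Q_k=k$, written as $Q_0(x)=\tau_0$ and $Q_k(x)=\tau_kx\,Q_{k-1}(x)-\sum_{j=0}^{k-1}a_{j,k}Q_j(x)$ for $k=1,\dots,n$ (so all $\tau_k\neq0$). The generalized associated (Horner) polynomials $\widehat Q_0,\dots,\widehat Q_{n-1}$ are defined by $$\widehat Q_0(x)=\widehat\tau_0,\qquad\widehat Q_k(x)=\widehat\tau_kx\,\widehat Q_{k-1}(x)-\sum_{j=0}^{k-1}\widehat a_{j,k}\widehat Q_j(x),\quad k=1,\dots,n-1,$$ $$\widehat\tau_k=\tau_{n-k}\ (k=0,\dots,n-1),\qquad\widehat a_{j,k}=\frac{\tau_{n-k}}{\tau_{n-j}}a_{n-k,n-j}\ (k=1,\dots,n-1,\ j=0,\dots,k-1).$$ A polynomial system is called quasiseparable here if it satisfies a two-term recurrence of the displayed form. *)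

(* Defs.v *)
From HB Require Import structures.
From mathcomp Require Import all_boot all_order all_algebra.
From mathcomp Require Import complex reals.

Set Implicit Arguments.
Unset Strict Implicit.
Unset Printing Implicit Defensive.

Import GRing.Theory.
Local Open Scope ring_scope.

(* Systems and coefficient families are functions on nat; only the entries
   Q 0, ..., Q m (and coefficients with indices up to m) are constrained. *)

(* deg (Q k) = k, since [size] is the degree plus one. *)
Definition graded_system (F : fieldType) (m : nat) (Q : nat -> {poly F}) : Prop :=
  forall k : nat, (k <= m)%N -> size (Q k) = k.+1.

Definition general_recurrence (F : fieldType) (m : nat)
    (tau : nat -> F) (a : nat -> nat -> F) (Q : nat -> {poly F}) : Prop :=
  Q 0%N = (tau 0%N)%:P /\
  forall k : nat, (1 <= k <= m)%N ->
    Q k = tau k *: ('X * Q (k - 1)%N) - \sum_(0 <= j < k) a j k *: Q j.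

Definition tau_hat (F : fieldType) (n : nat) (tau : nat -> F) : nat -> F :=
  fun k => tau (n - k)%N.

Definition a_hat (F : fieldType) (n : nat) (tau : nat -> F)
    (a : nat -> nat -> F) : nat -> nat -> F :=
  fun j k => tau (n - k)%N / tau (n - j)%N * a (n - k)%N (n - j)%N.

(* Qhat 0, ..., Qhat (n - 1) are the generalized associated polynomials of
   Q 0, ..., Q n.  When deg (Q k) = k, the relevant tau and a exist and are
   determined by Q, so the existential is only a way of naming them. *)
Definition generalized_associated (F : fieldType) (n : nat)
    (Q Qhat : nat -> {poly F}) : Prop :=
  exists (tau : nat -> F) (a : nat -> nat -> F),
    general_recurrence n tau a Q /\
    general_recurrence (n - 1) (tau_hat n tau) (a_hat n tau a) Qhat.

(* The matrix recurrence, written row by row. *)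
Definition two_term_recurrence (F : fieldType) (m : nat)
    (alpha beta gamma delta theta : nat -> F) (G Q : nat -> {poly F}) : Prop :=
  G 0%N = 0 /\
  forall k : nat, (1 <= k <= m)%N ->
    G k = alpha k *: G (k - 1)%N + beta k *: Q (k - 1)%N /\
    Q k = gamma k *: G (k - 1)%N
          + (delta k *: 'X + (theta k)%:P) * Q (k - 1)%N.

Definition quasiseparable (F : fieldType) (m : nat) (Q : nat -> {poly F}) : Prop :=
  graded_system m Q /\
  exists (alpha beta gamma delta theta : nat -> F) (G : nat -> {poly F}),
    two_term_recurrence m alpha beta gamma delta theta G Q.

(* Main.v *)
Require Import Defs.
From mathcomp Require Import all_boot all_order all_algebra.
From mathcomp Require Import complex reals.
From mathcomp Require Import zify ring.
Import GRing.Theory.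
Local Open Scope ring_scope.

(** Unrolling the two-term recurrence from [G 0 = 0] eliminates the auxiliary
    polynomials: [G k] is the combination of [Q 0, ..., Q (k - 1)] in which
    [Q j] has coefficient
    [beta (j + 1) * alpha (j + 2) * ... * alpha k].
    So a system satisfies a two-term recurrence exactly when it satisfies the
    long recurrence with [tau k = delta k], [a (k - 1) k = - theta k] and
    [a j k = - gamma k * alpha (k - 1) * ... * alpha (j + 2) * beta (j + 1)]
    for [j < k - 1] ([two_termP]).

    Since [deg (Q k) = k], the polynomials [Q 0, ..., Q (k - 1), x Q (k - 1)]
    are linearly independent, hence the long recurrence determines its
    coefficients ([general_recurrence_uniq]), and those of the given system are
    the ones above.  Passing to the associated system replaces the index pair
    [(j, k)] by [(n - k, n - j)].  This reverses the chain
    [gamma, alpha, ..., alpha, beta], so that [beta] and [gamma] exchange their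
    roles, and the factor [tau (n - k) / tau (n - j)] splits between the two
    ends of the chain ([a_hat_two_term_coef]).  The new coefficients thus have
    the two-term shape again, and [two_termP] in the other direction yields the
    auxiliary polynomials.  The degrees are right because the factors
    [tau (n - k)] of [x] do not vanish. *)

(** * Long recurrences and degrees *)

Section LongRecurrence.
Context {F : fieldType}.
Implicit Types (Q : nat -> {poly F}) (tau delta : nat -> F).
Implicit Types a : nat -> nat -> F.

Lemma size_sum_graded {k : nat} (c : nat -> F) {Q} :
  (forall j, (j < k)%N -> size (Q j) = j.+1) ->
  (size (\sum_(0 <= j < k) c j *: Q j)%R <= k)%N.
Proof.
move=> sQ; rewrite big_mkord; apply: (leq_trans (size_sum _ _ _)).
apply/bigmax_leqP => j _; apply: (leq_trans (size_scale_leq _ _)).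
by rewrite sQ.
Qed.

Lemma graded_free {k : nat} {c : nat -> F} {Q} :
  (forall j, (j < k)%N -> size (Q j) = j.+1) ->
  \sum_(0 <= j < k) c j *: Q j = 0 -> forall j, (j < k)%N -> c j = 0.
Proof.
elim: k => [//|k IHk] sQ; rewrite big_nat_recr //= => sum0.
have sQk j : (j < k)%N -> size (Q j) = j.+1 by move=> ltjk; apply: sQ; lia.
(* The coefficient of degree k only sees the last term. *)
have ck0 : c k = 0.
  have /(congr1 (fun p : {poly F} => p`_k)) := sum0.
  rewrite coefD coefZ coef0 (nth_default _ (size_sum_graded c sQk)) add0r.
  have -> : (Q k)`_k = lead_coef (Q k) by rewrite lead_coefE sQ.
  move/eqP; rewrite mulf_eq0 lead_coef_eq0 -size_poly_eq0 sQ // orbF.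
  by move/eqP.
move=> j; rewrite ltnS leq_eqVlt => /predU1P[-> //|]; apply: IHk => //.
by move: sum0; rewrite ck0 scale0r addr0.
Qed.

Lemma size_mulX_graded {k : nat} {Q} :
  size (Q k) = k.+1 -> size ('X * Q k) = k.+2.
Proof. by move=> sQ; rewrite mulrC size_mulX ?sQ // -size_poly_eq0 sQ. Qed.

Lemma general_recurrence_uniq {m : nat} {tau a delta b Q} :
  graded_system m Q ->
  (forall k, (1 <= k <= m)%N ->
     Q k = tau k *: ('X * Q (k - 1)%N) - \sum_(0 <= j < k) a j k *: Q j) ->
  (forall k, (1 <= k <= m)%N ->
     Q k = delta k *: ('X * Q (k - 1)%N) - \sum_(0 <= j < k) b j k *: Q j) ->
  forall k, (1 <= k <= m)%N ->
    tau k = delta k /\ forall j, (j < k)%N -> a j k = b j k.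
Proof.
move=> sQ rec_a rec_b k lekm.
(* Subtracting the two recurrences gives a relation between x Q (k - 1) and
   Q 0, ..., Q (k - 1); these form the graded family P, since x Q (k - 1) has
   the degree of Q k, and the coefficients c of the relation vanish. *)
pose P j := if j == k then 'X * Q (k - 1)%N else Q j.
pose c j := if j == k then tau k - delta k else b j k - a j k.
have sP j : (j < k.+1)%N -> size (P j) = j.+1.
  rewrite /P => ltjk; case: eqP => [->|_]; last by apply: sQ; lia.
  rewrite size_mulX_graded; first by lia.
  by apply: sQ; lia.
have c0 : forall j, (j < k.+1)%N -> c j = 0.
  apply: (graded_free sP); rewrite big_nat_recr //= {2}/c {2}/P eqxx.
  have -> : \sum_(0 <= j < k) c j *: P j
          = \sum_(0 <= j < k) b j k *: Q j - \sum_(0 <= j < k) a j k *: Q j.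
    rewrite -sumrB; apply: eq_big_nat => j /andP[_ ltjk].
    by rewrite /c /P ltn_eqF // scalerBl.
  rewrite -[RHS](subrr (Q k)) {1}(rec_a k lekm) (rec_b k lekm) scalerBl.
  by rewrite opprB addrACA [RHS]addrACA; congr (_ + _); rewrite addrC.
split=> [|j ltjk].
  by have := c0 k (leqnn _); rewrite /c eqxx => /eqP; rewrite subr_eq0 => /eqP.
have := c0 j (leqW ltjk); rewrite /c ltn_eqF // => /eqP.
by rewrite subr_eq0 => /eqP.
Qed.

Lemma general_recurrence_tau_neq0 {m : nat} {tau a Q} :
  graded_system m Q -> general_recurrence m tau a Q ->
  forall k, (k <= m)%N -> tau k != 0.
Proof.
move=> sQ [Q0 recQ] [|k] lekm; apply/eqP => tau0.
  by have := sQ 0%N lekm; rewrite Q0 tau0 size_poly0.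
have := sQ k.+1 lekm; rewrite recQ // tau0 scale0r sub0r size_polyN => szk.
have sQk j : (j < k.+1)%N -> size (Q j) = j.+1 by move=> ?; apply: sQ; lia.
by have := size_sum_graded (a^~ k.+1) sQk; rewrite szk ltnn.
Qed.

Lemma general_recurrence_graded {m : nat} {tau a Q} :
  general_recurrence m tau a Q -> (forall k, (k <= m)%N -> tau k != 0) ->
  graded_system m Q.
Proof.
move=> [Q0 recQ] tau_neq0; elim/ltn_ind => -[|k] IHk lekm.
  by rewrite Q0 size_polyC tau_neq0.
have sQk j : (j < k.+1)%N -> size (Q j) = j.+1 by move=> ?; apply: IHk; lia.
have szX : size (tau k.+1 *: ('X * Q k)) = k.+2.
  by rewrite size_scale ?tau_neq0 // size_mulX_graded ?sQk.
rewrite recQ // subn1 size_polyDl szX // size_polyN ltnS.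
exact: (size_sum_graded (a^~ k.+1) sQk).
Qed.

End LongRecurrence.

(** * Elimination of the auxiliary polynomials *)

Section TwoTerm.
Context {F : fieldType}.
Implicit Types (alpha beta gamma delta theta : nat -> F).
Implicit Types (Q G : nat -> {poly F}).

Definition aux_coef alpha beta (j k : nat) : F :=
  beta j.+1 * \prod_(j.+2 <= i < k.+1) alpha i.

Definition aux_poly alpha beta Q (k : nat) : {poly F} :=
  \sum_(0 <= j < k) aux_coef alpha beta j k *: Q j.

(** The sign is that of the long recurrence, which subtracts its sum. *)
Definition two_term_coef alpha beta gamma theta (j k : nat) : F :=
  - (if j.+1 == k then theta k else gamma k * aux_coef alpha beta j k.-1).

Lemma aux_polyS alpha beta Q k :
  aux_poly alpha beta Q k.+1
    = alpha k.+1 *: aux_poly alpha beta Q k + beta k.+1 *: Q k.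
Proof.
rewrite /aux_poly big_nat_recr //=; congr (_ + _); last first.
  by rewrite /aux_coef big_geq // mulr1.
rewrite scaler_sumr; apply: eq_big_nat => j /andP[_ ltjk].
by rewrite /aux_coef big_nat_recr //= scalerA mulrA (mulrC (alpha _)).
Qed.

Lemma two_term_aux_poly {m : nat} {alpha beta gamma delta theta G Q} :
  two_term_recurrence m alpha beta gamma delta theta G Q ->
  forall k, (k <= m)%N -> G k = aux_poly alpha beta Q k.
Proof.
move=> [G0 recG]; elim=> [|k IHk] lekm; first by rewrite G0 /aux_poly big_geq.
have [-> _] := recG k.+1 lekm.
by rewrite subn1 /= aux_polyS IHk // ltnW.
Qed.

Lemma two_term_long alpha beta gamma delta theta Q k :
  gamma k.+1 *: aux_poly alpha beta Q k
    + (delta k.+1 *: 'X + (theta k.+1)%:P) * Q k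
  = delta k.+1 *: ('X * Q k)
    - \sum_(0 <= j < k.+1) two_term_coef alpha beta gamma theta j k.+1 *: Q j.
Proof.
rewrite big_nat_recr //= {2}/two_term_coef eqxx.
have -> : \sum_(0 <= j < k) two_term_coef alpha beta gamma theta j k.+1 *: Q j
        = - (gamma k.+1 *: aux_poly alpha beta Q k).
  rewrite /aux_poly scaler_sumr -sumrN; apply: eq_big_nat => j /andP[_ ltjk].
  by rewrite /two_term_coef eqSS ltn_eqF //= scaleNr scalerA.
rewrite scaleNr -opprD opprK mulrDl mul_polyC scalerAl.
by rewrite addrCA.
Qed.

(** The two-term form is only a constraint on the coefficients of the long
    recurrence: [aux_poly] serves as the auxiliary family for any [Q]. *)
Lemma two_termP (m : nat) alpha beta gamma delta theta Q :
  (exists G, two_term_recurrence m alpha beta gamma delta theta G Q) <->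
  (forall k, (1 <= k <= m)%N ->
     Q k = delta k *: ('X * Q (k - 1)%N)
           - \sum_(0 <= j < k) two_term_coef alpha beta gamma theta j k *: Q j).
Proof.
split=> [[G recG] [//|k] lekm|recQ].
  have [_ ->] := recG.2 k.+1 lekm.
  rewrite subn1 /= (two_term_aux_poly recG) 1?ltnW //.
  exact: two_term_long.
exists (aux_poly alpha beta Q); split; first by rewrite /aux_poly big_geq.
move=> [//|k] lekm; rewrite subn1 /=; split; first exact: aux_polyS.
by rewrite (recQ k.+1 lekm) subn1 two_term_long.
Qed.

End TwoTerm.

(** * Coefficients of the associated system *)

Section Associated.
Context {F : fieldType}.
Implicit Types (alpha beta gamma delta theta : nat -> F).

Lemma prod_nat_reflect (n l k : nat) (f : nat -> F) : (k <= n.+1)%N ->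
  \prod_(l <= i < k) f (n - i)%N = \prod_(n.+1 - k <= i < n.+1 - l) f i.
Proof.
move=> lekn; rewrite big_nat_rev -{1}(add0n l) -{1}(add0n (n.+1 - k)%N).
rewrite !big_addn.
have -> : (n.+1 - l - (n.+1 - k) = k - l)%N by lia.
by apply: eq_big_nat => i ltik; congr f; lia.
Qed.

(** Reflecting the indices by [(j, k) |-> (n - k, n - j)] turns a chain
    [gamma, alpha, ..., alpha, beta] into the reversed one.  Of the factor
    [delta (n - k) / delta (n - j)], the numerator joins [beta (n - k + 1)] to
    form the new [gamma k], and the denominator joins [gamma (n - j)] to form
    the new [beta (j + 1)]; on the subdiagonal [j + 1 = k] it stays with
    [theta]. *)
Lemma a_hat_two_term_coef (n j k : nat) alpha beta gamma delta theta :
  (j < k)%N -> (k <= n)%N ->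
  a_hat n delta (two_term_coef alpha beta gamma theta) j k
  = two_term_coef
      (fun k => alpha (n - k + 1)%N)
      (fun k => gamma (n - k + 1)%N / delta (n - k + 1)%N)
      (fun k => beta (n - k + 1)%N * delta (n - k)%N)
      (fun k => delta (n - k)%N / delta (n - k + 1)%N * theta (n - k + 1)%N)
      j k.
Proof.
move=> ltjk lekn; rewrite /a_hat /two_term_coef mulrN; congr (- _).
have -> : ((n - k).+1 == n - j)%N = (j.+1 == k) by lia.
case: eqP => [<-|neqjk]; first by have -> : (n - j.+1 + 1 = n - j)%N by lia.
rewrite /aux_coef.
have -> : k.-1.+1 = k by lia.
have -> : (n - j).-1.+1 = (n - j)%N by lia.
have -> : (n - j.+1 + 1 = n - j)%N by lia.
have -> : (n - k + 1 = (n - k).+1)%N by lia.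
have -> : \prod_(j.+2 <= i < k) alpha (n - i + 1)%N
        = \prod_((n - k).+2 <= i < n - j) alpha i.
  have -> : (n - k).+2 = (n.+2 - k)%N by lia.
  have -> : (n - j = n.+2 - j.+2)%N by lia.
  rewrite -prod_nat_reflect; last by lia.
  by apply: eq_big_nat => i ltik; congr alpha; lia.
by ring.
Qed.

(** The long recurrence of the associated system only involves [tau i] and
    [a i j] with [i >= 1], exactly the ones that uniqueness of coefficients
    identifies with [delta i] and [two_term_coef] ([tau 0] and [delta 0] are
    unrelated). *)
Lemma generalized_associated_two_term {n : nat} {Q G Qhat : nat -> {poly F}}
    {alpha beta gamma delta theta} :
  (1 <= n)%N -> graded_system n Q ->
  two_term_recurrence n alpha beta gamma delta theta G Q ->
  generalized_associated n Q Qhat ->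
  graded_system (n - 1) Qhat /\
  exists Ghat : nat -> {poly F},
    two_term_recurrence (n - 1)
      (fun k => alpha (n - k + 1)%N)
      (fun k => gamma (n - k + 1)%N / delta (n - k + 1)%N)
      (fun k => beta (n - k + 1)%N * delta (n - k)%N)
      (fun k => delta (n - k)%N)
      (fun k => delta (n - k)%N / delta (n - k + 1)%N * theta (n - k + 1)%N)
      Ghat Qhat.
Proof.
move=> n_gt0 sQ recQ [tau [a [genQ genQhat]]].
have longQ := (two_termP _ _ _ _ _ _ _).1 (ex_intro _ G recQ).
have coefQ := general_recurrence_uniq sQ genQ.2 longQ.
split.
  apply: (general_recurrence_graded genQhat) => k _.
  by apply: (general_recurrence_tau_neq0 sQ genQ); lia.
apply/two_termP => k lekn; rewrite (genQhat.2 k lekn) /tau_hat.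
rewrite (coefQ (n - k)%N _).1; last by lia.
congr (_ - _); apply: eq_big_nat => j /andP[_ ltjk]; congr (_ *: _).
rewrite -a_hat_two_term_coef //; last by lia.
have [|tau_k _] := coefQ (n - k)%N; first by lia.
have [|tau_j a_j] := coefQ (n - j)%N; first by lia.
by rewrite /a_hat tau_k tau_j a_j //; lia.
Qed.

End Associated.

Theorem lemma4p1 (R : realType) (n : nat) (hn : (1 <= n)%N)
  (Q G : nat -> {poly (complex R)})
  (alpha beta gamma delta theta : nat -> complex R)
  (hdeg : graded_system n Q)
  (hrec : two_term_recurrence n alpha beta gamma delta theta G Q)
  (Qhat : nat -> {poly (complex R)})
  (hQhat : generalized_associated n Q Qhat) :
  quasiseparable (n - 1) Qhat /\
  exists Ghat : nat -> {poly (complex R)},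
    two_term_recurrence (n - 1)
      (fun k => alpha (n - k + 1)%N)
      (fun k => gamma (n - k + 1)%N / delta (n - k + 1)%N)
      (fun k => beta (n - k + 1)%N * delta (n - k)%N)
      (fun k => delta (n - k)%N)
      (fun k => delta (n - k)%N / delta (n - k + 1)%N * theta (n - k + 1)%N)
      Ghat Qhat.
Proof.
have [sQhat recQhat] := generalized_associated_two_term hn hdeg hrec hQhat.
split=> //; split=> //.
by do 5!eexists; exact: recQhat.
Qed.
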